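(* If $A\subseteq\mathbb N$ is quasi-maximal, then $E_A$ is not high for the computable FS-jump.
   Context: A c.e. set is maximal if its complement is infinite and for every c.e. set $W$, either $W\setminus A$ or $W^c\setminus A$ is finite; a c.e. set is quasi-maximal if it is the intersection of finitely many maximal sets. $E_A$ is the equivalence relation with $m\mathrel{E_A}n$ iff $m=n$ or $m,n\in A$. $\phi_e$ is the $e$-th partial computable function, $W_e$ its domain; $=^{ce}$ is $e=^{ce}e'$ iff $W_e=W_{e'}$. The computable FS-jump is $E^+$ with $e\mathrel{E^+}e'$ iff $\{[\phi_e(n)]_E:\phi_e(n)\downarrow\}=\{[\phi_{e'}(n)]_E:\phi_{e'}(n)\downarrow\}$. $E\leq F$ means there is a total computable $f$ with $x\mathrel{E}y\iff f(x)\mathrel{F}f(y)$. A ceer $E$ is high for the computable FS-jump if $E^+$ is computably bireducible with $=^{ce}$. *)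

(* Defs.v *)
From mathcomp Require Import all_boot all_classical.
From Stdlib Require Cantor.

Set Implicit Arguments.
Unset Strict Implicit.
Unset Printing Implicit Defensive.

Local Open Scope classical_set_scope.

Definition cpair (x y : nat) : nat := Cantor.to_nat (x, y).

Lemma cpair_inj x y x' y' : cpair x y = cpair x' y' -> x = x' /\ y = y'.
Proof.
by move=> /(f_equal Cantor.of_nat); rewrite !Cantor.cancel_of_to => -[-> ->].
Qed.

Lemma cpair_surj z : exists x y, z = cpair x y.
Proof.
exists (Cantor.of_nat z).1, (Cantor.of_nat z).2.
by rewrite /cpair -surjective_pairing Cantor.cancel_to_of.
Qed.

(* [phi e x y] is Kleene's {e}(x) = y, the graph of the e-th partial computable
   function.  An index is <tag, parameters>, the tag naming one of the closure
   schemes that generate the unary partial recursive functions modulo the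
   bijective Cantor pairing; tags above 7 index the nowhere defined function.
   The derivation of the minimization scheme requires the values at all
   i < n to be defined (and nonzero). *)
Inductive phi : nat -> nat -> nat -> Prop :=
| phi_zero p x : phi (cpair 0 p) x 0
| phi_succ p x : phi (cpair 1 p) x x.+1
| phi_left p x y : phi (cpair 2 p) (cpair x y) x
| phi_right p x y : phi (cpair 3 p) (cpair x y) y
| phi_pair a b x u v :
    phi a x u -> phi b x v -> phi (cpair 4 (cpair a b)) x (cpair u v)
| phi_comp a b x u v :
    phi b x u -> phi a u v -> phi (cpair 5 (cpair a b)) x v
| phi_prec0 a b x v :
    phi a x v -> phi (cpair 6 (cpair a b)) (cpair x 0) v
| phi_precS a b x n u v :
    phi (cpair 6 (cpair a b)) (cpair x n) u ->
    phi b (cpair x (cpair n u)) v ->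
    phi (cpair 6 (cpair a b)) (cpair x n.+1) v
| phi_mu a x n (w : nat -> nat) :
    (forall i, i < n -> phi a (cpair x i) (w i).+1) ->
    phi a (cpair x n) 0 ->
    phi (cpair 7 a) x n.

Lemma phi_functional e x y z : phi e x y -> phi e x z -> y = z.
Proof.
suff gen : forall e x y, phi e x y ->
    forall e' x' z, phi e' x' z -> e = e' -> x = x' -> y = z.
  by move=> H /(gen _ _ _ H); apply.
move=> {}e {}x {}y; induction 1; move=> e' x' z' [];
  intros; subst;
  repeat match goal with
  | E : cpair _ _ = cpair _ _ |- _ => apply cpair_inj in E as [? ?]
  end; try discriminate; subst => //.
- by congr cpair; eauto.
- have E : u = u0 by eauto.
  by subst; eauto.
- by eauto.
- match goal with E : _.+1 = _.+1 |- _ => case: E => ? end; subst.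
  match goal with K : phi _ (cpair _ _) ?t |- _ => have E : u = t by eauto end.
  by subst; eauto.
- match goal with |- n = ?m => case: (ltngtP n m) => // lt_nm end.
  + by have := IHphi _ _ _ (p _ lt_nm) erefl erefl.
  + by have := H0 _ lt_nm _ _ _ p0 erefl erefl.
Qed.

Definition W (e : nat) : set nat := [set x | exists y, phi e x y].

Definition ce (A : set nat) : Prop := exists e, A = W e.

Definition computable (f : nat -> nat) : Prop :=
  exists e, forall x, phi e x (f x).

Definition maximal (A : set nat) : Prop :=
  [/\ ce A, infinite_set (~` A) &
      forall V, ce V -> finite_set (V `\` A) \/ finite_set (~` V `\` A)].

Definition quasi_maximal (A : set nat) : Prop :=
  ce A /\ exists (k : nat) (M : nat -> set nat),
    (forall i, i < k -> maximal (M i)) /\ A = \bigcap_(i < k) M i.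

Definition E_ (A : set nat) (m n : nat) : Prop := m = n \/ (A m /\ A n).

Definition eq_ce (e e' : nat) : Prop := W e = W e'.

Definition eclass (E : nat -> nat -> Prop) (x : nat) : set nat :=
  [set y | E x y].

Definition class_range (E : nat -> nat -> Prop) (e : nat) : set (set nat) :=
  [set eclass E y | y in [set y | exists n, phi e n y]].

Definition FS_jump (E : nat -> nat -> Prop) (e e' : nat) : Prop :=
  class_range E e = class_range E e'.

Definition reducible (E F : nat -> nat -> Prop) : Prop :=
  exists f, computable f /\ forall x y, E x y <-> F (f x) (f y).

Definition bireducible (E F : nat -> nat -> Prop) : Prop :=
  reducible E F /\ reducible F E.

Definition high_for_FS_jump (E : nat -> nat -> Prop) : Prop :=
  bireducible (FS_jump E) eq_ce.

(* Main.v *)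
Require Import Defs.
From mathcomp Require Import all_boot all_classical.
From Stdlib Require Cantor.

(* A reduction f of =^ce to (E_A)^+ sends c.e. sets injectively to c.e.
   E_A-saturated sets, and, being extensional and computable, it is monotone
   for inclusion (a Myhill-Shepherdson argument).  Apply it to a chain of
   c.e. sets of order type omega * omega: the images D_0, D_1, ... of the limit
   stages increase with infinite differences B_i = D_(i+1) \ D_i, and by
   saturation at most one B_i meets A.  If A is the intersection of the maximal
   sets M_0, ..., M_(k-1), each other B_i has infinitely many points outside
   some M_j; by pigeonhole two of them share the same j, so that a c.e. set
   D_(i+1) splits the complement of M_j into two infinite parts. *)

Set Implicit Arguments.
Unset Strict Implicit.
Unset Printing Implicit Defensive.

Local Open Scope classical_set_scope.

(** * Pairing and closure properties of the total computable functions *)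

Definition fstn (z : nat) : nat := (Cantor.of_nat z).1.
Definition sndn (z : nat) : nat := (Cantor.of_nat z).2.

Lemma cpairK z : cpair (fstn z) (sndn z) = z.
Proof. by rewrite /cpair -surjective_pairing Cantor.cancel_to_of. Qed.

Lemma fstn_cpair x y : fstn (cpair x y) = x.
Proof. by rewrite /fstn /cpair Cantor.cancel_of_to. Qed.

Lemma sndn_cpair x y : sndn (cpair x y) = y.
Proof. by rewrite /sndn /cpair Cantor.cancel_of_to. Qed.

Definition cpairE := (fstn_cpair, sndn_cpair).

Lemma computable_comp f g :
  computable f -> computable g -> computable (fun x => f (g x)).
Proof.
move=> [a fa] [b gb]; exists (cpair 5 (cpair a b)) => x.
exact: phi_comp (gb x) (fa _).
Qed.

Lemma computable_pair f g :
  computable f -> computable g -> computable (fun x => cpair (f x) (g x)).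
Proof.
by move=> [a fa] [b gb]; exists (cpair 4 (cpair a b)) => x; apply: phi_pair.
Qed.

Lemma computable_succ f : computable f -> computable (fun x => (f x).+1).
Proof.
by apply: (@computable_comp succn); exists (cpair 1 0) => x; apply: phi_succ.
Qed.

Lemma computable_fst f : computable f -> computable (fun x => fstn (f x)).
Proof.
apply: (@computable_comp fstn); exists (cpair 2 0) => x.
by rewrite -{1}(cpairK x); apply: phi_left.
Qed.

Lemma computable_snd f : computable f -> computable (fun x => sndn (f x)).
Proof.
apply: (@computable_comp sndn); exists (cpair 3 0) => x.
by rewrite -{1}(cpairK x); apply: phi_right.
Qed.

Lemma computable_id : computable (fun x => x).
Proof.
exists (cpair 4 (cpair (cpair 2 0) (cpair 3 0))) => x.
rewrite -(cpairK x); apply: phi_pair; [exact: phi_left|exact: phi_right].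
Qed.

Lemma computable_const c : computable (fun=> c).
Proof.
elim: c => [|c IH]; last exact: computable_succ.
by exists (cpair 0 0) => x; apply: phi_zero.
Qed.

(** Primitive recursion with a parameter: the packing [<x, <n, u>>] of parameter, counter and
    accumulator is the one used by [phi_precS]. All arithmetic and boolean operations below reduce
    to this scheme. *)
Lemma computable_iteri k h a :
  computable k ->
  computable (fun z => h (fstn z) (fstn (sndn z)) (sndn (sndn z))) ->
  computable a ->
  computable (fun x => iteri (k x) (h x) (a x)).
Proof.
move=> ck [ih Hh] [ia Ha].
suff cR : computable
    (fun z => iteri (sndn z) (h (fstn z)) (a (fstn z))).
  have := computable_comp cR (computable_pair computable_id ck).
  by congr computable; apply/funext => x; rewrite !cpairE.
exists (cpair 6 (cpair ia ih)) => z; rewrite -{1}(cpairK z).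
elim: (sndn z) => [|n IHn] /=; first exact: phi_prec0.
apply: phi_precS IHn _.
by have := Hh (cpair (fstn z) (cpair n (iteri n (h (fstn z)) (a (fstn z)))));
   rewrite !cpairE.
Qed.

Lemma computable_iter k h a :
  computable k -> computable (fun z => h (fstn z) (sndn z)) -> computable a ->
  computable (fun x => iter (k x) (h x) (a x)).
Proof.
move=> ck ch ca.
have := @computable_iteri k (fun x _ => h x) a ck _ ca.
have E : (fun x => iteri (k x) (fun=> h x) (a x)) =
         (fun x => iter (k x) (h x) (a x)).
  by apply/funext => x; elim: (k x) => //= n ->.
rewrite E; apply.
have := computable_comp ch (computable_pair (computable_fst computable_id)
  (computable_snd (computable_snd computable_id))).
by congr computable; apply/funext => x; rewrite !cpairE.
Qed.

Lemma computable_pred f : computable f -> computable (fun x => (f x).-1).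
Proof.
move=> cf.
(* Each round forgets the accumulator and returns the counter, so the last round returns the
   predecessor; with no round the value is 0. *)
have := @computable_iteri f (fun _ i _ => i) (fun=> 0) cf
  (computable_fst (computable_snd computable_id)) (computable_const 0).
by congr computable; apply/funext => x; case: (f x).
Qed.

Lemma computable_sub f g :
  computable f -> computable g -> computable (fun x => f x - g x).
Proof.
move=> cf cg.
have := @computable_iter g (fun=> predn) f cg
  (computable_pred (computable_snd computable_id)) cf.
congr computable; apply/funext => x.
by elim: (g x) => [|n /= ->]; rewrite ?subn0 ?subnS.
Qed.

(** * Decidable predicates and bounded quantifiers *)

Definition dec (b : nat -> bool) : Prop :=
  computable (fun x => nat_of_bool (b x)).

Lemma dec_and b c : dec b -> dec c -> dec (fun x => b x && c x).
Proof.
move=> cb cc.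
(* The truth value of [b x] is itself the number of rounds: none leaves 0, one returns [c x]. *)
have := @computable_iteri b (fun x _ _ => c x) (fun=> 0) cb
  (computable_comp cc (computable_fst computable_id)) (computable_const 0).
by congr computable; apply/funext => x; case: (b x).
Qed.

Lemma dec_eq0 f : computable f -> dec (fun x => f x == 0).
Proof.
move=> cf.
have := @computable_iteri f (fun _ _ _ => 0) (fun=> 1) cf
  (computable_const 0) (computable_const 1).
by congr computable; apply/funext => x; case: (f x).
Qed.

Lemma dec_not b : dec b -> dec (fun x => ~~ b x).
Proof.
move=> /dec_eq0; congr dec; apply/funext => x; by case: (b x).
Qed.

Lemma dec_or b c : dec b -> dec c -> dec (fun x => b x || c x).
Proof.
move=> cb cc; have := dec_not (dec_and (dec_not cb) (dec_not cc)).
by congr dec; apply/funext => x; rewrite negb_and !negbK.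
Qed.

Lemma dec_le f g : computable f -> computable g -> dec (fun x => f x <= g x).
Proof. by move=> cf cg; apply/dec_eq0/computable_sub. Qed.

Lemma dec_eq f g : computable f -> computable g -> dec (fun x => f x == g x).
Proof.
move=> cf cg; have := dec_and (dec_le cf cg) (dec_le cg cf).
by congr dec; apply/funext => x; rewrite eqn_leq.
Qed.

Lemma dec_has_iota n p :
  computable n -> dec (fun z => p (fstn z) (sndn z)) ->
  dec (fun x => has (p x) (iota 0 (n x))).
Proof.
move=> cn cp.
(* The accumulator is a number read as a flag: once nonzero, it stays so. *)
have := @computable_iteri n (fun x i b => ~~ (b == 0) || p x i) (fun=> 0)
  cn _ (computable_const 0).
have E : (fun x => iteri (n x) (fun i b => ~~ (b == 0) || p x i) 0) =
         (fun x => has (p x) (iota 0 (n x)) : nat).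
  apply/funext => x; elim: (n x) => // m IHm.
  by rewrite -[in RHS]addn1 iotaD has_cat /= IHm orbF; case: has.
rewrite E; apply; apply: dec_or.
  exact/dec_not/dec_eq0/computable_snd/computable_snd/computable_id.
have := computable_comp cp (computable_pair (computable_fst computable_id)
  (computable_fst (computable_snd computable_id))).
by congr computable; apply/funext => x; rewrite !cpairE.
Qed.

Lemma dec_all_iota n p :
  computable n -> dec (fun z => p (fstn z) (sndn z)) ->
  dec (fun x => all (p x) (iota 0 (n x))).
Proof.
move=> cn cp.
have := dec_not (@dec_has_iota n (fun x i => ~~ p x i) cn (dec_not cp)).
congr dec; apply/funext => x.
by rewrite -all_predC; apply: eq_all => i /=; rewrite negbK.
Qed.

(* A number [l] codes an infinite sequence, the list of its first components
   under iterated second projection; only finite prefixes are ever used. *)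
Definition entry (l i : nat) : nat := fstn (iter i sndn l).

Lemma entry_surj (s : seq nat) :
  exists l, forall i, i < size s -> entry l i = nth 0 s i.
Proof.
elim: s => [|a s [l Hl]]; first by exists 0.
exists (cpair a l) => -[|i] ilt /=; first by rewrite /entry /= cpairE.
by rewrite /entry iterSr cpairE; apply: Hl.
Qed.

Lemma dec_has_entry l n p :
  computable l -> computable n -> dec (fun z => p (fstn z) (sndn z)) ->
  dec (fun x => has (p x) (mkseq (entry (l x)) (n x))).
Proof.
move=> cl cn cp.
have := @dec_has_iota n (fun x i => p x (entry (l x) i)) cn _.
have -> : (fun x => has (fun i => p x (entry (l x) i)) (iota 0 (n x))) =
          (fun x => has (p x) (mkseq (entry (l x)) (n x))).
  by apply/funext => x; rewrite has_map.
apply.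
have ce : computable (fun z => entry (l (fstn z)) (sndn z)).
  apply/computable_fst/(@computable_iter _ (fun=> sndn)).
  - exact/computable_snd/computable_id.
  - exact/computable_snd/computable_snd/computable_id.
  - exact/(computable_comp cl)/computable_fst/computable_id.
have := computable_comp cp (computable_pair (computable_fst computable_id) ce).
by congr computable; apply/funext => x; rewrite !cpairE.
Qed.

Ltac comput := repeat first
  [ assumption | exact: computable_id | exact: computable_const
  | match goal with
    | H : computable ?f |- computable (fun z => ?f (@?g z)) =>
        apply: (computable_comp H)
    | H : dec ?f |- dec (fun z => ?f (@?g z)) =>
        apply: (computable_comp H)
    end
  | apply: computable_pair | apply: computable_succ | apply: computable_fst
  | apply: computable_snd | apply: computable_pred
  | apply: dec_and | apply: dec_or | apply: dec_not | apply: dec_le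
  | apply: dec_eq | apply: dec_has_entry | apply: dec_all_iota ].

(** * Finite derivations of [phi] facts as decidable objects, and the normal form theorem *)

Definition triple (e x y : nat) : nat := cpair e (cpair x y).

Definition knows (s : seq nat) (e x y : nat) : bool :=
  has (fun t => t == triple e x y) s.

(* [justified s e x y]: the triple follows by one clause of [phi] from triples
   in [s]; existential witnesses are results of triples in [s]. *)
Definition justified (s : seq nat) (e x y : nat) : bool :=
  let tag := fstn e in let p := sndn e in
  let a := fstn p in let b := sndn p in
  (tag == 0) && (y == 0) ||
  (tag == 1) && (y == x.+1) ||
  (tag == 2) && (y == fstn x) ||
  (tag == 3) && (y == sndn x) ||
  (tag == 4) && (knows s a x (fstn y) && knows s b x (sndn y)) ||
  (tag == 5) && has (fun t => let u := sndn (sndn t) in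
                              knows s b x u && knows s a u y) s ||
  (tag == 6) && ((sndn x == 0) && knows s a (fstn x) y) ||
  (tag == 6) && (~~ (sndn x == 0) &&
    has (fun t => let u := sndn (sndn t) in
           knows s e (cpair (fstn x) (sndn x).-1) u &&
           knows s b (cpair (fstn x) (cpair (sndn x).-1 u)) y) s) ||
  (tag == 7) && (knows s p (cpair x y) 0 &&
    all (fun i => has (fun t => let u := sndn (sndn t) in
                         ~~ (u == 0) && knows s p (cpair x i) u) s) (iota 0 y)).

(** Taking a function and a length, rather than a list, serves both coded sequences [entry l] and
    actual lists [nth 0 s]. *)
Definition valid (w : nat -> nat) (n : nat) : bool :=
  all (fun i => justified (mkseq w i) (fstn (w i)) (fstn (sndn (w i)))
                          (sndn (sndn (w i)))) (iota 0 n).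

Lemma dec_knows l n e x y :
  computable l -> computable n ->
  computable e -> computable x -> computable y ->
  dec (fun z => knows (mkseq (entry (l z)) (n z)) (e z) (x z) (y z)).
Proof. by move=> *; rewrite /knows /triple; comput. Qed.

Lemma dec_justified l n e x y :
  computable l -> computable n ->
  computable e -> computable x -> computable y ->
  dec (fun z => justified (mkseq (entry (l z)) (n z)) (e z) (x z) (y z)).
Proof.
by move=> *; rewrite /justified /=; comput; apply: dec_knows; comput.
Qed.

Lemma computable_entry l i :
  computable l -> computable i -> computable (fun z => entry (l z) (i z)).
Proof.
move=> cl ci; apply/computable_fst/(@computable_iter _ (fun=> sndn)) => //.
by comput.
Qed.

Lemma dec_valid l n :
  computable l -> computable n -> dec (fun z => valid (entry (l z)) (n z)).
Proof.
move=> cl cn; apply: dec_all_iota => //.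
have ct : computable (fun z => entry (l (fstn z)) (sndn z)).
  by apply: computable_entry; comput.
by apply: dec_justified; comput.
Qed.

Lemma knows_in s e x y : knows s e x y = (triple e x y \in s).
Proof. by rewrite /knows has_pred1. Qed.

(** [knows] and the searches through [s] occur only positively in [justified]. *)
Lemma justified_sub s s' e x y :
  {subset s <= s'} -> justified s e x y -> justified s' e x y.
Proof.
move=> sub.
have K e' x' y' : knows s e' x' y' -> knows s' e' x' y'.
  by rewrite !knows_in; apply: sub.
have hs (p q : pred nat) : (forall t, p t -> q t) -> has p s -> has q s'.
  by move=> pq /hasP[t ts pt]; apply/hasP; exists t; [exact: sub|exact: pq].
have b_or (p q p' q' : bool) : (p -> p') -> (q -> q') -> p || q -> p' || q'.
  by move=> pp qq /orP[/pp->|/qq->] //; rewrite orbT.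
have b_and (p q p' q' : bool) : (p -> p') -> (q -> q') -> p && q -> p' && q'.
  by move=> ? ? /andP[? ?]; apply/andP; split; auto.
rewrite /justified /=.
repeat match goal with |- is_true (_ || _) -> _ => apply: (b_or) end.
all: apply: (b_and) => //.
- by apply: (b_and); apply: (K).
- by apply: (hs) => t; apply: (b_and); apply: (K).
- by apply: (b_and) => //; apply: (K).
- by apply: (b_and) => //; apply: (hs) => t; apply: (b_and); apply: (K).
- apply: (b_and); first exact: K.
  by apply: sub_all => i; apply: (hs) => t; apply: (b_and) => //; apply: (K).
Qed.

Definition derivation (s : seq nat) : bool := valid (nth 0 s) (size s).

Lemma derivationP s :
  reflect (forall i, i < size s ->
             justified (take i s) (fstn (nth 0 s i)) (fstn (sndn (nth 0 s i)))
                       (sndn (sndn (nth 0 s i))))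
          (derivation s).
Proof.
apply: (iffP allP) => H i.
  move=> ilt; have := H i; rewrite mem_iota /= /mkseq map_nth_iota0 //.
    by apply.
  exact: ltnW.
by rewrite mem_iota /= => /[dup] ilt /H; rewrite /mkseq map_nth_iota0 // ltnW.
Qed.

Lemma derivation_rcons s e x y :
  derivation s -> justified s e x y -> derivation (rcons s (triple e x y)).
Proof.
move=> /derivationP ds js; apply/derivationP => i.
rewrite size_rcons ltnS leq_eqVlt => /predU1P[->|ilt].
  by rewrite nth_rcons ltnn eqxx -cats1 take_size_cat // /triple !cpairE.
rewrite nth_rcons ilt -cats1 takel_cat ?(ltnW ilt) //; exact: ds.
Qed.

(** Extra earlier entries never invalidate a justification. This allows the derivations of several
    premises to be merged. *)
Lemma derivation_cat s1 s2 :
  derivation s1 -> derivation s2 -> derivation (s1 ++ s2).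
Proof.
move=> /derivationP d1 /derivationP d2; apply/derivationP => i.
rewrite size_cat nth_cat take_cat; case: (ltnP i (size s1)) => [ilt _|ige ilt].
  exact: d1.
apply: (@justified_sub (take (i - size s1) s2)).
  by move=> t ts; rewrite mem_cat ts orbT.
by apply: d2; rewrite ltn_subLR.
Qed.

Definition derivable (e x y : nat) : Prop :=
  exists2 s, derivation s & knows s e x y.

Lemma derivable_justified s e x y :
  derivation s -> justified s e x y -> derivable e x y.
Proof.
move=> ds js; exists (rcons s (triple e x y)); first exact: derivation_rcons.
by rewrite knows_in mem_rcons mem_head.
Qed.

Lemma knows_catl s1 s2 e x y : knows s1 e x y -> knows (s1 ++ s2) e x y.
Proof. by rewrite /knows has_cat => ->. Qed.

Lemma knows_catr s1 s2 e x y : knows s2 e x y -> knows (s1 ++ s2) e x y.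
Proof. by rewrite /knows has_cat orbC => ->. Qed.

Lemma derivable2 e x y e' x' y' :
  derivable e x y -> derivable e' x' y' ->
  exists s, [/\ derivation s, knows s e x y & knows s e' x' y'].
Proof.
move=> [s ds ks] [s' ds' ks']; exists (s ++ s'); split.
- exact: derivation_cat.
- exact: knows_catl.
- exact: knows_catr.
Qed.

(** Supplies the intermediate values that [justified] seeks among the results listed in [s]. *)
Lemma has_result s e x y (p : nat -> bool) :
  knows s e x y -> p y -> has (fun t => p (sndn (sndn t))) s.
Proof.
rewrite knows_in => ks py; apply/hasP; exists (triple e x y) => //.
by rewrite /triple !cpairE.
Qed.

Lemma phi_derivable e x y : phi e x y -> derivable e x y.
Proof.
elim=> {e x y}.
- by move=> p x; apply: (@derivable_justified [::]) => //;
    rewrite /justified !cpairE /= ?eqxx.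
- by move=> p x; apply: (@derivable_justified [::]) => //;
    rewrite /justified !cpairE /= ?eqxx.
- by move=> p x y; apply: (@derivable_justified [::]) => //;
    rewrite /justified !cpairE /= ?eqxx.
- by move=> p x y; apply: (@derivable_justified [::]) => //;
    rewrite /justified !cpairE /= ?eqxx.
- move=> a b x u v _ da _ db; have [s [ds ka kb]] := derivable2 da db.
  by apply: (derivable_justified ds); rewrite /justified !cpairE /= ka kb ?orbT.
- move=> a b x u v _ db _ da; have [s [ds kb ka]] := derivable2 db da.
  apply: (derivable_justified ds); rewrite /justified !cpairE /= ?orbF.
  by apply: (has_result (p := fun u => knows s b x u && knows s a u v) kb);
    rewrite kb.
- move=> a b x v _ [s ds ka].
  by apply: (derivable_justified ds); rewrite /justified !cpairE /= ka.
- move=> a b x n u v _ dn _ db; have [s [ds kn kb]] := derivable2 dn db.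
  apply: (derivable_justified ds); rewrite /justified !cpairE /= ?orbF.
  by apply: (has_result (p := fun u =>
      knows s (cpair 6 (cpair a b)) (cpair x n) u &&
      knows s b (cpair x (cpair n u)) v) kn);
    rewrite kn.
- move=> a x n w _ dw _ d0.
  (* Minimization has n + 1 premises; their derivations are concatenated one at a time, by induction
     on [m]. *)
  have upto m : m <= n -> exists s, [/\ derivation s,
      knows s a (cpair x n) 0 &
      forall i, i < m -> knows s a (cpair x i) (w i).+1].
    elim: m => [_|m IHm mn]; first by case: d0 => s ds ks; exists s.
    have [s [ds k0 kw]] := IHm (ltnW mn).
    have [s' ds' k'] := dw _ mn.
    exists (s ++ s'); split; [exact: derivation_cat|exact: knows_catl|].
    move=> i; rewrite ltnS leq_eqVlt => /predU1P[->|/kw].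
      exact: knows_catr.
    exact: knows_catl.
  have [s [ds k0 kw]] := upto n (leqnn n).
  apply: (derivable_justified ds); rewrite /justified !cpairE /= k0 /=.
  apply/allP => i; rewrite mem_iota /= => /kw ki.
  by apply: (has_result (p := fun u =>
      ~~ (u == 0) && knows s a (cpair x i) u) ki).
Qed.

Lemma justified_sound s e x y :
  (forall e' x' y', knows s e' x' y' -> phi e' x' y') ->
  justified s e x y -> phi e x y.
Proof.
have [tag [p ->]] := cpair_surj e; have [a [b ->]] := cpair_surj p.
have [x0 [x1 ->]] := cpair_surj x; have [y0 [y1 ->]] := cpair_surj y.
move=> ks; rewrite /justified !cpairE.
case: tag => [|[|[|[|[|[|[|[|tag]]]]]]]] /=; rewrite ?orbF ?andbF //=.
- by move=> /eqP->; apply: phi_zero.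
- by move=> /eqP->; apply: phi_succ.
- by move=> /eqP->; apply: phi_left.
- by move=> /eqP->; apply: phi_right.
- by move=> /andP[/ks ? /ks ?]; apply: phi_pair.
- by move=> /hasP[t _ /andP[/ks ? /ks ?]]; apply: phi_comp; eauto.
- case: x1 => [|n] /=; rewrite ?orbF; first by move=> /ks; apply: phi_prec0.
  by move=> /hasP[t _ /andP[/ks ? /ks ?]]; apply: phi_precS; eauto.
- move=> /andP[/ks k0 /allP kw].
  (* [phi_mu] asks for a single function giving the predecessors of the nonzero values; outside the
     searched range its value is the arbitrary 0. *)
  have /choice[w Hw] : forall i, exists u,
      i < cpair y0 y1 -> phi (cpair a b) (cpair (cpair x0 x1) i) u.+1.
    move=> i; case: (ltnP i (cpair y0 y1)) => [ilt|]; last by exists 0.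
    have /hasP[t _] := kw i (ltac:(by rewrite mem_iota)).
    by case: (sndn (sndn t)) => //= u /ks ?; exists u.
  exact: phi_mu Hw k0.
Qed.

(** Strong induction on the position of the triple: a justification cites strictly earlier entries
    only. *)
Lemma valid_sound w n e x y :
  valid w n -> knows (mkseq w n) e x y -> phi e x y.
Proof.
move=> /allP vw; rewrite knows_in => /mapP[i]; rewrite mem_iota /= => ilt E.
suff : phi (fstn (w i)) (fstn (sndn (w i))) (sndn (sndn (w i))).
  by rewrite -E /triple !cpairE.
elim/ltn_ind: i {E} ilt => i IHi ilt.
apply: (justified_sound (s := mkseq w i)); last first.
  by apply: vw; rewrite mem_iota.
move=> e' x' y'; rewrite knows_in => /mapP[j]; rewrite mem_iota /= => jlt E.
by have := IHi j jlt (ltn_trans jlt ilt); rewrite -E /triple !cpairE.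
Qed.

(** Kleene's normal form: with [dec_valid] and [dec_knows], the graph of the universal function is a
    projection of a decidable relation. *)
Lemma phiE e x y : phi e x y <->
  exists l n, valid (entry l) n && knows (mkseq (entry l) n) e x y.
Proof.
split=> [/phi_derivable[s ds ks]|[l [n /andP[]]]]; last exact: valid_sound.
have [l Hl] := entry_surj s; exists l, (size s).
have E i : i <= size s -> mkseq (entry l) i = take i s.
  move=> ile; rewrite -(map_nth_iota0 0) //; apply/eq_in_map => j.
  by rewrite mem_iota /= => jlt; apply/Hl/(leq_trans jlt).
rewrite E // take_size ks andbT; apply/allP => i; rewrite mem_iota /= => ilt.
by rewrite (E _ (ltnW ilt)) Hl //; apply: (elimT (derivationP s)).
Qed.

(** * C.e. sets: projections of decidable relations, closure properties, the s-m-n theorem *)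

Lemma phi_mu_root a x n : phi (cpair 7 a) x n -> phi a (cpair x n) 0.
Proof.
move E: (cpair 7 a) => e p; case: p E;
  by intros; match goal with
     | K : cpair _ _ = cpair _ _ |- _ => apply cpair_inj in K as [? ?]
     end; subst.
Qed.

(** One direction packs the output and the coded derivation into a single witness; the other
    searches for a witness by minimization. *)
Lemma ceP A :
  ce A <-> exists2 b, dec b & forall x, A x <-> exists n, b (cpair x n).
Proof.
split=> [[e ->]|[b /dec_not[i Hi] bP]].
  exists (fun z =>
      let l := fstn (sndn (sndn z)) in let n := sndn (sndn (sndn z)) in
      valid (entry l) n &&
      knows (mkseq (entry l) n) e (fstn z) (fstn (sndn z))).
    by apply: dec_and; [apply: dec_valid|apply: dec_knows]; comput.
  move=> x; split=> [[y /phiE[l [n H]]]|[n]].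
    by exists (cpair y (cpair l n)); rewrite !cpairE.
  rewrite !cpairE => H; exists (fstn n); apply/phiE.
  by do 2 eexists; exact: H.
(* The index [i] computes the negation of [b], so the zeros sought by minimization are the witnesses
   of [b]. *)
exists (cpair 7 i); apply/seteqP; split=> [x /bP ex|x [n px]].
  have [n bn least] := ex_minnP ex; exists n.
  (* Below the least witness the negation has value 1, the successor of this constant 0. *)
  apply: (@phi_mu _ _ _ (fun=> 0)) => [k kn|]; last first.
    by have := Hi (cpair x n); rewrite bn.
  have := Hi (cpair x k); case bk: (b _) => //=.
  by have := least _ bk; rewrite leqNgt kn.
apply/bP; exists n; have := phi_functional (phi_mu_root px) (Hi _).
by case: (b _).
Qed.

Lemma ce_comp A f : ce A -> computable f -> ce [set x | A (f x)].
Proof.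
move=> /ceP[b db bP] cf; apply/ceP.
exists (fun z => b (cpair (f (fstn z)) (sndn z))).
  by comput.
by move=> x /=; rewrite bP; split=> -[n]; exists n; move: p; rewrite !cpairE.
Qed.

Lemma ce_dec b : dec b -> ce [set x | b x].
Proof.
move=> db; apply/ceP; exists (fun z => b (fstn z)); first by comput.
by move=> x /=; split=> [bx|[n]]; [exists 0|]; rewrite cpairE.
Qed.

Lemma ce_setI A B : ce A -> ce B -> ce (A `&` B).
Proof.
move=> /ceP[b db bP] /ceP[c dc cP]; apply/ceP.
exists (fun z => b (cpair (fstn z) (fstn (sndn z))) &&
                 c (cpair (fstn z) (sndn (sndn z)))); first by comput.
move=> x; split=> [[/bP[n bn] /cP[m cm]]|[n /andP[]]].
  by exists (cpair n m); rewrite !cpairE bn.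
by rewrite !cpairE => bn cn; split; [apply/bP|apply/cP]; eexists; eauto.
Qed.

Lemma ce_setU A B : ce A -> ce B -> ce (A `|` B).
Proof.
move=> /ceP[b db bP] /ceP[c dc cP]; apply/ceP.
exists (fun z => b z || c z); first by comput.
move=> x; split=> [[/bP|/cP] [n H]|[n /orP[H|H]]].
- by exists n; rewrite H.
- by exists n; rewrite H orbT.
- by left; apply/bP; exists n.
- by right; apply/cP; exists n.
Qed.

Lemma ce_ex A : ce A -> ce [set x | exists y, A (cpair x y)].
Proof.
move=> /ceP[b db bP]; apply/ceP.
exists (fun z => b (cpair (cpair (fstn z) (fstn (sndn z))) (sndn (sndn z)))).
  by comput.
move=> x; split=> [[y /bP[n bn]]|[n]].
  by exists (cpair y n); rewrite !cpairE.
by rewrite !cpairE => bn; exists (fstn n); apply/bP; eexists; eauto.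
Qed.

Lemma ce_phi : ce [set z | phi (fstn z) (fstn (sndn z)) (sndn (sndn z))].
Proof.
pose b z := let e := fstn (fstn (fstn z)) in
  let x := fstn (sndn (fstn (fstn z))) in
  let y := sndn (sndn (fstn (fstn z))) in
  let l := sndn (fstn z) in let n := sndn z in
  valid (entry l) n && knows (mkseq (entry l) n) e x y.
have db : dec b.
  by apply: dec_and; [apply: dec_valid|apply: dec_knows]; comput.
have := ce_ex (ce_ex (ce_dec db)).
congr ce; apply/seteqP; split=> z /=.
  by move=> [l [n]]; rewrite /b !cpairE => H; apply/phiE; exists l, n.
by move=> /phiE[l [n H]]; exists l, n; rewrite /b !cpairE.
Qed.

Lemma ce_W : ce [set z | W (fstn z) (sndn z)].
Proof.
pose f z := cpair (fstn (fstn z)) (cpair (sndn (fstn z)) (sndn z)).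
have cf : computable f by comput.
have := ce_ex (ce_comp ce_phi cf).
by congr ce; apply/seteqP; split=> z [y p]; exists y; move: p;
   rewrite /= /f !cpairE.
Qed.

Lemma phi_comp_inv a b x v :
  phi (cpair 5 (cpair a b)) x v -> exists2 u, phi b x u & phi a u v.
Proof.
move E: (cpair 5 (cpair a b)) => e p; case: p E;
  intros; repeat match goal with
  | K : cpair _ _ = cpair _ _ |- _ => apply cpair_inj in K as [? ?]
  end; subst => //; eauto.
Qed.

(** An index of [A] is composed with an index of the map sending [z] to [<x, z>], and the latter
    index is computable from [x]. *)
Lemma smn A : ce A ->
  exists2 f, computable f & forall x, W (f x) = [set z | A (cpair x z)].
Proof.
move=> [r ->].
(* An index of the constant function with value [x]: the zero function followed by [x]
   successors. *)
pose cst x := iter x (fun c => cpair 5 (cpair (cpair 1 0) c)) (cpair 0 0).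
have cstP x z : phi (cst x) z x.
  elim: x => [|x IHx]; first exact: phi_zero.
  by apply: phi_comp IHx _; apply: phi_succ.
have ccst : computable cst.
  by apply: (@computable_iter _ (fun _ c => cpair 5 (cpair (cpair 1 0) c)));
    comput.
have [id_ idP] := computable_id.
exists (fun x => cpair 5 (cpair r (cpair 4 (cpair (cst x) id_)))).
  by comput.
move=> x; have pairP z : phi (cpair 4 (cpair (cst x) id_)) z (cpair x z).
  exact: phi_pair.
apply/seteqP; split=> z [y p]; exists y.
  by have [u /(phi_functional (pairP z)) ->] := phi_comp_inv p.
exact: phi_comp (pairP z) p.
Qed.

(** * The jump of [E_ A] in terms of saturated c.e. sets, and monotonicity of reductions *)

Definition saturation (A : set nat) (e : nat) : set nat :=
  [set y | exists n z, phi e n z /\ E_ A z y].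

(** A set of equivalence classes and its union determine each other: the classes are those of the
    points of the union. *)
Lemma FS_jumpP A e e' :
  FS_jump (E_ A) e e' <-> saturation A e = saturation A e'.
Proof.
have Erefl x : E_ A x x by left.
have Esym x y : E_ A x y -> E_ A y x by case=> [->|[? ?]]; [left|right].
have Etrans y x z : E_ A x y -> E_ A y z -> E_ A x z.
  by move=> [->//|[? ?]] [<-|[? ?]]; right.
have sE a : saturation A a = \bigcup_(C in class_range (E_ A) a) C.
  apply/seteqP; split=> y.
    move=> [n [z [p zy]]]; exists (eclass (E_ A) z) => //.
    by exists z => //; exists n.
  by move=> [_ [z [n p] <-] zy]; exists n, z.
have cE a : class_range (E_ A) a = [set eclass (E_ A) y | y in saturation A a].
  apply/seteqP; split=> C [z].
    by move=> [n p] <-; exists z => //; exists n, z.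
  move=> [n [u [p uz]]] <-; exists u; first by exists n.
  by apply/seteqP; split=> y /=; apply: Etrans => //; apply: Esym.
by rewrite /FS_jump; split=> H; [rewrite !sE H|rewrite !cE H].
Qed.

Lemma saturation_saturated A e x y :
  saturation A e x -> A x -> A y -> saturation A e y.
Proof.
move=> [n [z [p zx]]] Ax Ay; exists n, z; split=> //; right; split=> //.
by case: zx => [->|[]].
Qed.

Lemma ce_saturation A : ce A -> ce [set t | saturation A (fstn t) (sndn t)].
Proof.
move=> ceA.
(* Two applications of [ce_ex] quantify over [n] and [z], so the matrix is a condition on
   [t = <<<e, y>, n>, z>]. *)
pose n t := sndn (fstn t). pose z t := sndn t.
pose e t := fstn (fstn (fstn t)). pose y t := sndn (fstn (fstn t)).
have cp : computable (fun t => cpair (e t) (cpair (n t) (z t))) by comput.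
have cz : computable z by comput.
have cy : computable y by comput.
have := ce_ex (ce_ex (ce_setI (ce_comp ce_phi cp)
  (ce_setU (ce_dec (dec_eq cz cy))
           (ce_setI (ce_comp ceA cz) (ce_comp ceA cy))))).
congr ce; apply/seteqP; split=> t [n0 [z0 [p H]]];
  exists n0, z0; move: p H; rewrite /= /z /e /n /y !cpairE => p H;
  split=> //; case: H => [|[? ?]].
- by move=> /eqP->; left.
- by right.
- by move=> ->; left; exact: eqxx.
- by right.
Qed.

(* Were y in the image of W_i but not in that of the larger W_j, the sets equal
   to W_j for x in the halting set and to W_i otherwise would have y in their
   image exactly off the halting set, whose complement would then be c.e. *)
Lemma saturation_mono A f : ce A ->
  computable f -> (forall e e', W e = W e' -> FS_jump (E_ A) (f e) (f e')) ->
  forall i j, W i `<=` W j -> saturation A (f i) `<=` saturation A (f j).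
Proof.
move=> ceA cf fE i j ij y yi; apply: contrapT => yj.
have ceW (e : nat -> nat) (x : nat -> nat) : computable e -> computable x ->
    ce [set t | W (e t) (x t)].
  move=> ce_ cx; have := ce_comp ce_W (computable_pair ce_ cx).
  by congr ce; apply/seteqP; split=> t /=; rewrite !cpairE.
have ceB : ce ([set t | W i (sndn t)] `|`
               ([set t | W j (sndn t)] `&` [set t | W (fstn t) (fstn t)])).
  by apply: ce_setU; [|apply: ce_setI]; apply: ceW; comput.
have [g cg gE] := smn ceB.
have cgy : computable (fun x => cpair (f (g x)) y) by comput.
have [d dE] := ce_comp (ce_saturation ceA) cgy.
have {}dE x : W d x <-> saturation A (f (g x)) y.
  by rewrite -dE /= !cpairE.
have nK x : ~ W x x -> W d x.
  move=> nx; apply/dE; suff /fE/FS_jumpP-> : W (g x) = W i by [].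
  rewrite gE; apply/seteqP; split=> z /=; rewrite !cpairE; last by left.
  by case=> // -[].
have K x : W x x -> ~ W d x.
  move=> xx /dE; suff /fE/FS_jumpP-> : W (g x) = W j by [].
  rewrite gE; apply/seteqP; split=> z /=; rewrite !cpairE; last by right.
  by case=> [/ij|[]].
(* [W d] would be the complement of the diagonal halting set; its own index [d] gives the
   contradiction. *)
by have [/[dup] /K|/[dup] /nK] := pselect (W d d).
Qed.

(** * The chain of order type omega * omega and the contradiction with maximality *)

Lemma infinite_injective (g : nat -> nat) (X : set nat) :
  injective g -> (forall n, X (g n)) -> infinite_set X.
Proof.
move=> gi gX fX; apply: infinite_nat.
have := finite_preimage (in2W gi) fX; congr finite_set.
by apply/seteqP; split=> // n _; apply: gX.
Qed.

Theorem theorem4p14 (A : set nat) :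
  quasi_maximal A -> ~ high_for_FS_jump (E_ A).
Proof.
move=> [ceA [k [M [maxM AE]]]] [_ [f [cf fE]]].
(* [C (i, n)] holds the codes of the pairs lexicographically below [(i, n)]; the limit stages are
   the [C (i, 0)]. *)
pose C (p : nat * nat) : set nat :=
  [set z | (fstn z < p.1) || (fstn z == p.1) && (sndn z < p.2)].
have /choice[c cE] : forall p, exists e, C p = W e.
  by move=> p; apply: ce_dec; rewrite /C; comput.
pose D i n := saturation A (f (c (i, n))).
have Dmono i n j m : C (i, n) `<=` C (j, m) -> D i n `<=` D j m.
  rewrite !cE; apply: saturation_mono => // e e' ee'; exact/fE.
(* The code of [(i, n)] separates the two stages of the chain, and a reduction keeps distinct c.e.
   sets distinct. *)
have Dne i n : D i n <> D i n.+1.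
  move=> /FS_jumpP/fE; rewrite /eq_ce -!cE => CE.
  have : C (i, n.+1) (cpair i n) by rewrite /C /= !cpairE ltnn eqxx ltnSn.
  by rewrite -CE /C /= !cpairE !ltnn andbF.
have DS i n m : n <= m -> D i n `<=` D i m.
  move=> nm; apply: Dmono => z /orP[?|/andP[? ?]]; apply/orP; [by left|right].
  by apply/andP; split=> //; apply: leq_trans nm.
have D0 i n : D i n `<=` D i.+1 0.
  apply: Dmono => z; rewrite /C /= !ltn0 andbF orbF ltnS => /orP[/ltnW //|].
  by case/andP=> /eqP->.
have D00 i j : i <= j -> D i 0 `<=` D j 0.
  move=> ij; apply: Dmono => z; rewrite /C /= !ltn0 !andbF !orbF => zi.
  exact: leq_trans ij.
have ceD i : ce (D i 0).
  have ccst : computable (fun y => cpair (f (c (i, 0))) y) by comput.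
  have := ce_comp (ce_saturation ceA) ccst.
  by congr ce; apply/seteqP; split=> y /=; rewrite !cpairE.
pose B i := D i.+1 0 `\` D i 0.
have infB i : infinite_set (B i).
  (* Each of the infinitely many strict steps between two limit stages contributes a new point
     [g n]. *)
  have /choice[g gP] : forall n, exists y, D i n.+1 y /\ ~ D i n y.
    move=> n; apply: contrapT => no; apply: (Dne i n).
    apply/seteqP; split=> [|y Dy]; first exact: DS.
    by apply: contrapT => nDy; apply: no; exists y.
  apply: (@infinite_injective g).
    have lt n m : n < m -> g n <> g m.
      by move=> nm E; apply: (gP m).2; rewrite -E; apply: DS nm _ (gP n).1.
    move=> n m E; case: (ltngtP n m) => // /lt; rewrite E //.
  move=> n; have [g1 g2] := gP n; split; first exact: D0 g1.
  by move=> /(DS _ _ _ (leq0n n)).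
(* If [B i] meets [A], saturation puts all of [A] into [D i.+1 0], and every later difference avoids
   [A]; hence the threshold [i.+1]. *)
have [i0 i0P] : exists i0, forall i, i0 <= i -> B i `<=` ~` A.
  have [[i [y [[Dy _] Ay]]]|no] := pselect (exists i, B i `&` A !=set0).
    exists i.+1 => j ij x [_ nDx] Ax; apply: nDx; apply: D00 ij _ _.
    exact: saturation_saturated Dy Ay Ax.
  by exists 0 => i _ x Bx Ax; apply: no; exists i, x.
(* Past [i0], the infinite set [B i] is covered by the finitely many [B i] minus [M j], so one of
   these is infinite. Below [i0] the value 0 is arbitrary. *)
have /choice[h hP] : forall i, exists j,
    i0 <= i -> j < k /\ infinite_set (B i `\` M j).
  move=> i; have [i0i|_] := leqP i0 i; last by exists 0.
  apply: contrapT => no; apply: (infB i).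
  have : finite_set (\bigcup_(j < k) (B i `\` M j)).
    apply: bigcup_finite; first exact: finite_II.
    move=> j jk; apply: contrapT => inf; apply: no; by exists j.
  apply: sub_finite_set => x Bx; apply: contrapT => nx.
  apply: (i0P _ i0i _ Bx); rewrite AE => j jk; apply: contrapT => nMj.
  by apply: nx; exists j.
(* Pigeonhole: the k + 1 indices from [i0] on take values among k maximal sets. *)
have hlt (i : 'I_k.+1) : h (i0 + i) < k by apply: (hP _ (leq_addr _ _)).1.
have /injectivePn[i1 [i2 i12 /(congr1 val) /= hE]] :
    ~~ injectiveb (fun i => Ordinal (hlt i)).
  by apply/injectiveP => /leq_card; rewrite !card_ord ltnn.
(* The c.e. set [D i.+1 0] contains [B i] and, since [i < j], is disjoint from [B j]; both have
   infinitely many points outside the same maximal set. *)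
have clash (i j : nat) : i0 <= i -> i < j -> h i = h j -> False.
  move=> i0i ij hij.
  have [hik infi] := hP _ i0i.
  have [_ infj] := hP _ (leq_trans i0i (ltnW ij)).
  have [_ _ /(_ _ (ceD i.+1))[]] := maxM _ hik.
    by move=> fin; apply: infi; apply: sub_finite_set fin => x [[Dx _] nM].
  move=> fin; apply: infj; apply: sub_finite_set fin.
  by rewrite hij => x [[_ nDx] nM]; split=> // /(D00 _ _ ij).
move: i12; rewrite -val_eqE neq_ltn => /orP[] lt12.
- by apply: clash _ _ hE; rewrite ?leq_addr ?ltn_add2l.
- by apply: clash _ _ (esym hE); rewrite ?leq_addr ?ltn_add2l.
Qed.
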